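(* Let $n \geq 2$ be an integer. Then $$N_2(n) = \{ A \in O_n(\mathbb{Q}) \mid A\mathbf{1} = \mathbf{1} \},$$ where $\mathbf{1} \in \mathbb{Q}^n$ is the all-one column vector. In particular, $N_2(n)$ forms a group under matrix multiplication.
   Context: For matrices $A=(a_{ij}), B=(b_{ij}) \in M_n(\mathbb{Q})$, write $[A]=_2^n[B]$ if the columns of $A$ and the columns of $B$, viewed as two (not necessarily disjoint) multisets of $n$ points of $\mathbb{Q}^n$, form a solution of the $n$-dimensional Prouhet--Tarry--Escott problem of degree $2$ and size $n$; that is, for all nonnegative integers $k_1,\ldots,k_n$ with $1 \le k_1+\cdots+k_n \le 2$, $$\sum_{j=1}^n a_{1j}^{k_1}\cdots a_{nj}^{k_n} = \sum_{j=1}^n b_{1j}^{k_1}\cdots b_{nj}^{k_n}.$$ Define $$N_2(n) = \{ A^{-1}B \in M_n(\mathbb{Q}) \mid A, B \in M_n(\mathbb{Q}),\ [A]=_2^n [B],\ \operatorname{rank} A=\operatorname{rank} B=n\}.$$ $O_n(\mathbb{Q}) = \{A \in \mathrm{GL}_n(\mathbb{Q}) \mid A^T A = I_n\}$ is the usual orthogonal group over $\mathbb{Q}$. *)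

(* Defs.v *)
From mathcomp Require Import all_boot all_order all_algebra.
From mathcomp Require Import classical_sets.

Set Implicit Arguments.
Unset Strict Implicit.
Unset Printing Implicit Defensive.

Import GRing.Theory.

Local Open Scope classical_set_scope.
Local Open Scope ring_scope.

(* The columns of A and of B, as two multisets of s points of Q^n, solve the
   n-dimensional Prouhet-Tarry-Escott problem of degree d: row i holds the i-th
   coordinates, and k is the exponent vector (with 0 ^+ 0 = 1). *)
Definition pte_solution (d n s : nat) (A B : 'M[rat]_(n, s)) : Prop :=
  forall k : 'I_n -> nat, (1 <= \sum_(i < n) k i <= d)%N ->
    \sum_(j < s) \prod_(i < n) A i j ^+ k i
      = \sum_(j < s) \prod_(i < n) B i j ^+ k i.

Definition N2 (n : nat) : set 'M[rat]_n :=
  [set M | exists A B : 'M[rat]_n,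
     [/\ pte_solution 2 A B, \rank A = n, \rank B = n & M = invmx A *m B]].
Arguments N2 : clear implicits.

Definition orthogonal_rat (n : nat) : set 'M[rat]_n :=
  [set A | A \in unitmx /\ A^T *m A = 1%:M].
Arguments orthogonal_rat : clear implicits.

Definition ones (n : nat) : 'cV[rat]_n := const_mx 1.

Definition forms_group (T : Type) (S : set T) (op : T -> T -> T) : Prop :=
  [/\ forall x y, S x -> S y -> S (op x y),
      forall x y z, S x -> S y -> S z -> op x (op y z) = op (op x y) z &
      exists e, [/\ S e,
        forall x, S x -> op e x = x /\ op x e = x &
        forall x, S x -> exists y, [/\ S y, op y x = e & op x y = e]]].

(* Main.v *)
(* In degree 2, the Prouhet-Tarry-Escott equations for A and B say exactly that
   A 1 = B 1 (degree 1 monomials) and A A^T = B B^T (degree 2 monomials).  For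
   invertible A and B this means that A^-1 B is orthogonal and fixes 1;
   conversely such a matrix M is obtained from the pair (I, M). *)
Require Import Defs.
From mathcomp Require Import all_boot all_order all_algebra.
From mathcomp Require Import classical_sets.

Import GRing.Theory.

Local Open Scope classical_set_scope.
Local Open Scope ring_scope.

(** The function [i == a], read as a number, is the unit exponent vector at [a]; adding it
    multiplies a monomial by the variable [x a] and raises its degree by one. *)
Lemma sum_exponents_add1 (I : finType) (a : I) (k : I -> nat) :
  (\sum_i ((i == a) + k i) = (\sum_i k i).+1)%N.
Proof.
rewrite big_split /= (bigD1 a) //= eqxx big1 //.
by move=> i /negbTE ->.
Qed.

Lemma prod_exponents_add1 (R : comNzRingType) (I : finType) (x : I -> R)
    (a : I) (k : I -> nat) :
  \prod_i x i ^+ ((i == a) + k i)%N = x a * \prod_i x i ^+ k i.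
Proof.
under eq_bigr do rewrite exprD.
rewrite big_split /=; congr (_ * _).
rewrite (bigD1 a) //= eqxx expr1 big1 ?mulr1 // => i /negbTE ->.
by rewrite expr0.
Qed.

(** Any index with a positive exponent can serve as [a]. Iterating this breaks a monomial of known
    degree into single variables. *)
Lemma exponents_add1_ex (I : finType) (k : I -> nat) (m : nat) :
  (\sum_i k i)%N = m.+1 ->
  exists a k', (forall i, k i = ((i == a) + k' i)%N) /\ (\sum_i k' i)%N = m.
Proof.
move=> sk.
have [a ka | k0] := pickP (fun i => (0 < k i)%N); last first.
  by move: sk; rewrite big1 // => i _; move: (k0 i); case: (k i).
(* The truncated subtraction loses nothing, since [k a] is positive. *)
have kE i : k i = ((i == a) + (k i - (i == a)))%N.
  by rewrite subnKC //; case: eqP => // ->.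
exists a, (fun i => k i - (i == a))%N; split=> //.
by move: sk; rewrite (eq_bigr _ (fun i _ => kE i)) sum_exponents_add1 => -[].
Qed.

Lemma prod_exponents0 (R : comNzRingType) (I : finType) (x : I -> R) (k : I -> nat) :
  (\sum_i k i)%N = 0%N -> \prod_i x i ^+ k i = 1.
Proof.
move/eqP; rewrite sum_nat_eq0 => /forallP k0.
by rewrite big1 // => i _; rewrite (eqP (k0 i)).
Qed.

Lemma pte_solution2E (n s : nat) (A B : 'M[rat]_(n, s)) :
  pte_solution 2 A B <-> A *m ones s = B *m ones s /\ A *m A^T = B *m B^T.
Proof.
have onesE (C : 'M[rat]_(n, s)) i z : (C *m ones s) i z = \sum_j C i j.
  by rewrite mxE; apply: eq_bigr => j _; rewrite mxE mulr1.
have gramE (C : 'M[rat]_(n, s)) a b : (C *m C^T) a b = \sum_j C a j * C b j.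
  by rewrite mxE; apply: eq_bigr => j _; rewrite mxE.
have prod1 (C : 'M[rat]_(n, s)) (a : 'I_n) (k : 'I_n -> nat) :
    (\sum_i k i)%N = 0%N ->
    \sum_j \prod_i C i j ^+ ((i == a) + k i)%N = \sum_j C a j.
  by move=> k0; apply: eq_bigr => j _;
    rewrite prod_exponents_add1 prod_exponents0 ?mulr1.
have prod2 (C : 'M[rat]_(n, s)) (a b : 'I_n) (k : 'I_n -> nat) :
    (\sum_i k i)%N = 0%N ->
    \sum_j \prod_i C i j ^+ ((i == a) + ((i == b) + k i))%N
      = \sum_j C a j * C b j.
  by move=> k0; apply: eq_bigr => j _;
    rewrite !prod_exponents_add1 prod_exponents0 ?mulr1.
have k0 : (\sum_(i < n) 0)%N = 0%N by rewrite big1.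
split=> [AB | [AB1 AB2] k].
  (* Test the equations on the exponent vectors e_a and e_a + e_b, written with the zero vector as
     remainder. *)
  split; apply/matrixP => a b.
    rewrite !onesE -!(prod1 _ a _ k0); apply: AB.
    by rewrite sum_exponents_add1 k0.
  rewrite !gramE -!(prod2 _ a b _ k0); apply: AB.
  by rewrite !sum_exponents_add1 k0.
(* Conversely, the degree is 1 or 2, so peeling off one or two unit vectors reduces any admissible
   [k] to e_a or e_a + e_b. *)
case sk: (\sum_i k i)%N => [|m] //= m_le1.
have [a [k1 [kE sk1]]] := exponents_add1_ex _ _ _ sk.
have prodE (C : 'M[rat]_(n, s)) (j : 'I_s) :
    \prod_i C i j ^+ k i = \prod_i C i j ^+ ((i == a) + k1 i)%N.
  by apply: eq_bigr => i _; rewrite kE.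
rewrite !(eq_bigr _ (fun j _ => prodE _ j)).
case: m => [|[|m]] // in m_le1 sk sk1.
  by rewrite !prod1 // -!(onesE _ a ord0) AB1.
have [b [k2 [k1E sk2]]] := exponents_add1_ex _ _ _ sk1.
have prodE1 (C : 'M[rat]_(n, s)) (j : 'I_s) :
    \prod_i C i j ^+ ((i == a) + k1 i)%N
      = \prod_i C i j ^+ ((i == a) + ((i == b) + k2 i))%N.
  by apply: eq_bigr => i _; rewrite k1E.
by rewrite !(eq_bigr _ (fun j _ => prodE1 _ j)) !prod2 // -!gramE AB2.
Qed.

Lemma N2E (n : nat) :
  N2 n = [set A : 'M[rat]_n | orthogonal_rat n A /\ A *m ones n = ones n].
Proof.
apply/seteqP; split=> [M [A [B [/pte_solution2E [AB1 AB2] rA rB ->]]] | M].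
  have uA : A \in unitmx by rewrite -row_free_unit /row_free rA.
  have uB : B \in unitmx by rewrite -row_free_unit /row_free rB.
  split; last by rewrite -mulmxA -AB1 mulKmx.
  split; first by rewrite unitmx_mul unitmx_inv uA.
  (* The Gram identity concerns rows, so M M^T = I is what it yields: A^-1 (B B^T) A^-T = A^-1 (A
     A^T) A^-T = I. For square matrices this gives M^T M = I. *)
  apply: mulmx1C.
  rewrite trmx_mul mulmxA -(mulmxA (invmx A)) -AB2 (mulKmx uA).
  by rewrite -trmx_mul mulVmx ?trmx1.
move=> [[uM MTM] M1]; exists 1%:M, M; split.
- apply/pte_solution2E; rewrite mul1mx M1 trmx1 mulmx1.
  by rewrite (mulmx1C MTM).
- exact: mxrank1.
- exact: mxrank_unit.
- by rewrite invmx1 mul1mx.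
Qed.

Theorem proposition2p1 (n : nat) (hn : (2 <= n)%N) :
  N2 n = [set A : 'M[rat]_n | orthogonal_rat n A /\ A *m ones n = ones n]
  /\ forms_group (N2 n) (fun A B : 'M[rat]_n => A *m B).
Proof.
split; first exact: N2E.
rewrite N2E; split.
- move=> A B [[uA AA] A1] [[uB BB] B1]; split; last by rewrite -mulmxA B1.
  split; first by rewrite unitmx_mul uA.
  by rewrite trmx_mul mulmxA -(mulmxA B^T) AA mulmx1.
- by move=> A B C _ _ _; rewrite mulmxA.
exists 1%:M; split.
- by split; [split; rewrite ?unitmx1 // trmx1 mulmx1 | rewrite mul1mx].
- by move=> A _; rewrite mul1mx mulmx1.
(* The inverse is the transpose, and it fixes the all-one vector because A^T 1 = A^T (A 1) = 1. *)
move=> A [[uA AA] A1]; exists A^T; split=> //; last exact: mulmx1C.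
split; last by rewrite -{1}A1 mulmxA AA mul1mx.
by split; [rewrite unitmx_tr | rewrite trmxK; apply: mulmx1C].
Qed.
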